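(* Let $K(r)$ be a translation-invariant kernel in the integral equation $$a\,\sigma(x)+\int_\Omega b(x)\,K(\|x-y\|)\,c(y)\,\sigma(y)\,d\Omega_y=f(x),\qquad x\in\Omega ,$$ where $\Omega\subset\mathbb{R}^D$ ($D\in\{1,2,3\}$) is a box, and let $\mathsf{A}=a\mathsf{I}+\mathsf{B}\mathsf{K}\mathsf{W}\mathsf{C}$ be the corresponding discretization matrix, sampled on a translation-invariant grid. Let $\mathsf{K}\mathsf{W}$ be FMM-compressible, with QTT ranks bounded by the constant $r_\varepsilon^{\mathsf{K}}$. Assume further that $b(x)$ and $c(y)$ both admit compact QTT representations, with ranks bounded by $r_\varepsilon^{\mathsf{b}}$ and $r_\varepsilon^{\mathsf{c}}$ respectively. Then the tensorized operator $\mathcal{A}_{\mathcal{T}}$ on the product tree $\mathcal{T}=\mathcal{T}_{\mathrm{src}}\times\mathcal{T}_{\mathrm{trg}}$ has bounded QTT ranks $r_k$: $$ r_\varepsilon^{\mathsf{A}}=\max_{k=1,\ldots,d} r_k\;\le\; r_\varepsilon^{\mathsf{b}}\,r_\varepsilon^{\mathsf{K}}\,r_\varepsilon^{\mathsf{c}}+1 .$$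
   Context: Discretization. The integral equation is discretized by a Nyström method with collocation points $x_i,y_j$ on a translation-invariant (regular) grid in $\Omega$ and quadrature weights $w_j$. $\mathsf{K}$ is the matrix with entries $K(\|x_i-y_j\|)$ (the possible singularity at $r=0$ being treated by the quadrature), and $\mathsf{B},\mathsf{C},\mathsf{W}$ are the diagonal matrices with diagonal entries $b(x_i)$, $c(y_j)$, $w_j$. Trees. $\mathcal{T}_{\mathrm{trg}}$ and $\mathcal{T}_{\mathrm{src}}$ are uniformly refined hierarchical partitions of $\Omega$ into boxes (target and source trees), both of depth $d$. At each level all boxes are translates of each other with identically placed sample points. Each non-leaf node has $m$ children (target) or $n$ children (source), and each leaf contains $m_1$ target or $n_1$ source points; put $m_k=m$, $n_k=n$ for $k\ge2$. Target points are indexed by $\overline{i_1\cdots i_d}$ with $i_k\le m_k$ and source points by $\overline{j_1\cdots j_d}$ with $j_k\le n_k$, where $i_k$ ($k\ge2$) says which child was taken at level $k$ (level $2$ finest, level $d$ root) and $i_1$ numbers points inside the leaf. An overline denotes the one-dimensional index obtained by flattening a multi-index in lexicographic order. Tensorization. A matrix $\mathsf{A}$ is tensorized as the $d$-tensor $$\mathcal{A}_{\mathcal{T}}(\overline{i_1j_1},\ldots,\overline{i_dj_d})=\mathsf{A}(\overline{i_1\cdots i_d},\overline{j_1\cdots j_d}),$$ and likewise for $\mathsf{K}\mathsf{W}$, $\mathsf{B}$, $\mathsf{C}$. The sampled functions $b$ and $c$ are tensorized as $(i_1,\ldots,i_d)\mapsto b(x_{\overline{i_1\cdots i_d}})$ and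 $(j_1,\ldots,j_d)\mapsto c(y_{\overline{j_1\cdots j_d}})$. QTT ranks. A tensor-train (TT) decomposition of a $d$-tensor is $$\sum_{\alpha_1,\ldots,\alpha_{d-1}}\mathcal{G}_1(\alpha_0,i_1,\alpha_1)\,\mathcal{G}_2(\alpha_1,i_2,\alpha_2)\cdots\mathcal{G}_d(\alpha_{d-1},i_d,\alpha_d),\qquad 1\le\alpha_k\le r_k,\quad r_0=r_d=1 .$$ The $\mathcal{G}_k$ are the cores and the $r_k$ the TT ranks; ''QTT'' means TT applied to a tensorized matrix or vector. The subscript $\varepsilon$ records dependence on the target accuracy $\varepsilon$: $r_\varepsilon^{\mathsf{b}}$, $r_\varepsilon^{\mathsf{c}}$, $r_\varepsilon^{\mathsf{K}}$ bound the ranks of the QTT representations of $b$, $c$, $\mathsf{K}\mathsf{W}$ for target accuracy $\varepsilon$, and $r_k$ are the ranks of the QTT representation of $\mathcal{A}_{\mathcal{T}}$, the representation of $\mathsf{A}=a\mathsf{I}+\mathsf{B}\mathsf{K}\mathsf{W}\mathsf{C}$ corresponding to these representations of its factors. FMM-compressibility. A pair of boxes $(B_i,B_j)\in\mathcal{T}_{\mathrm{trg}}\times\mathcal{T}_{\mathrm{src}}$ is well-separated if $\operatorname{dist}(B_i,B_j)\ge\max(\operatorname{diam}(B_i),\operatorname{diam}(B_j))$. The far field of a box $B_i$ at level $\ell$ is the set of source boxes at level $\ell$ well-separated from it. A matrix is FMM-compressible if, for the given accuracy $\varepsilon$, every sub-block corresponding to evaluation at $(x,y)\in S\times T$ for well-separated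 sets $S,T$ (including any box together with any subset of its far field) has numerical rank at accuracy $\varepsilon$ at most a constant $k_\varepsilon$.
   Formalization: When a ≠ 0, the source and target trees are required to have the same leaf sizes and child counts (m_1 = n_1, m = n); otherwise the identity I is undefined or its tensorization can have QTT rank above 1 and the bound fails. *)

(* Defs.v *)
From HB Require Import structures.
From mathcomp Require Import all_boot all_order all_algebra.
From mathcomp Require Import all_classical all_reals.

Set Implicit Arguments.
Unset Strict Implicit.
Unset Printing Implicit Defensive.

Import Order.TTheory GRing.Theory Num.Theory.

Local Open Scope classical_set_scope.
Local Open Scope ring_scope.

(** * Multi-indices, lexicographic flattening, tensorization

    Everything is 0-based: position [k : 'I_d] of a multi-index stands for
    [i_(k+1)], so position 0 numbers the points inside a leaf and position
    [k > 0] is the child taken when descending from tree level [k] to tree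
    level [k - 1]; level [d - 1] is the root and level 0 consists of the
    leaves. *)

Definition multi_index (d : nat) (s : nat -> nat) :=
  {dffun forall k : 'I_d, 'I_(s k)}.

Definition tree_modes (q1 q k : nat) : nat := if k == 0%N then q1 else q.

Definition flat_size (d : nat) (s : nat -> nat) : nat := (\prod_(k < d) s k)%N.

Definition flatten_nat (d : nat) (s : nat -> nat) (i : 'I_d -> nat) : nat :=
  (\sum_(k < d) i k * \prod_(l < d | k < l) s l)%N.

Lemma flatten_nat_lt (d : nat) (s : nat -> nat) (i : 'I_d -> nat) :
  (forall k, i k < s k)%N -> (flatten_nat s i < flat_size d s)%N.
Proof.
rewrite /flatten_nat /flat_size.
elim: d s i => [|d IHd] s i lt_is; first by rewrite !big_ord0.
rewrite !big_ord_recl /=.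
have -> : (\prod_(l < d.+1 | 0 < l) s l = \prod_(k < d) s k.+1)%N.
  by rewrite big_mkcond big_ord_recl /= mul1n.
have lt_tail := IHd (fun k => s k.+1) (fun k => i (lift ord0 k))
                    (fun k => lt_is (lift ord0 k)).
have eq_tail : (\sum_(k < d) i (lift ord0 k) * \prod_(l < d.+1 | bump 0 k < l) s l
    = \sum_(k < d) i (lift ord0 k) * \prod_(l < d | k < l) s l.+1)%N.
  apply: eq_bigr => k _; congr (_ * _)%N.
  by rewrite [LHS]big_mkcond big_ord_recl /= mul1n [RHS]big_mkcond.
rewrite eq_tail.
apply: (@leq_trans ((i ord0).+1 * \prod_(k < d) s k.+1)%N).
  by rewrite mulSn addnC ltn_add2r.
by rewrite leq_mul2r (lt_is ord0) orbT.
Qed.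

(* First index most significant. *)
Definition flatten_index (d : nat) (s : nat -> nat) (i : multi_index d s) :
    'I_(flat_size d s) :=
  Ordinal (flatten_nat_lt (fun k => ltn_ord (i k))).

(* [mxvec_index] is the lexicographic flattening of a pair. *)
Definition pair_index (d : nat) (s t : nat -> nat)
    (i : multi_index d s) (j : multi_index d t) :
    multi_index d (fun k => s k * t k)%N :=
  [ffun k : 'I_d => mxvec_index (i k) (j k)].

Definition mxvec_unindex (m n : nat) (p : 'I_(m * n)) : 'I_m * 'I_n :=
  enum_val (cast_ord (esym (mxvec_cast m n)) p).

Definition tensor (R : Type) (d : nat) (s : nat -> nat) := multi_index d s -> R.

Definition tensor_of_row (R : Type) (d : nat) (s : nat -> nat)
    (v : 'rV[R]_(flat_size d s)) : tensor R d s :=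
  fun i => v ord0 (flatten_index i).

Definition tensor_of_mx (R : Type) (d : nat) (s t : nat -> nat)
    (A : 'M[R]_(flat_size d s, flat_size d t)) :
    tensor R d (fun k => s k * t k)%N :=
  fun u => A (flatten_index [ffun k : 'I_d => (mxvec_unindex (u k)).1])
             (flatten_index [ffun k : 'I_d => (mxvec_unindex (u k)).2]).

Lemma tensor_of_mxE (R : Type) (d : nat) (s t : nat -> nat)
    (A : 'M[R]_(flat_size d s, flat_size d t))
    (i : multi_index d s) (j : multi_index d t) :
  tensor_of_mx A (pair_index i j) = A (flatten_index i) (flatten_index j).
Proof.
rewrite /tensor_of_mx; congr (A (flatten_index _) (flatten_index _));
  by apply/ffunP => k; rewrite !ffunE /mxvec_unindex cast_ordK enum_rankK.
Qed.

(** * Tensor trains *)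

(* The core [G k] has indices alpha_k < r k, i_k < s k, alpha_(k+1) < r (k+1). *)
Definition tt_eval (R : pzSemiRingType) (d : nat) (s r : nat -> nat)
    (G : forall k : nat, 'I_(r k) -> 'I_(s k) -> 'I_(r k.+1) -> R) :
    tensor R d s :=
  fun i => \sum_(al : {dffun forall k : 'I_d.+1, 'I_(r k)})
    \prod_(k < d) G k (al (widen_ord (leqnSn d) k)) (i k) (al (lift ord0 k)).

Definition has_tt_decomposition (R : pzSemiRingType) (d : nat) (s : nat -> nat)
    (T : tensor R d s) (r : nat -> nat) : Prop :=
  [/\ r 0%N = 1%N, r d = 1%N &
      exists G : forall k : nat, 'I_(r k) -> 'I_(s k) -> 'I_(r k.+1) -> R,
        forall i, T i = tt_eval G i].

Definition max_tt_rank (d : nat) (r : nat -> nat) : nat :=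
  (\max_(1 <= k < d.+1) r k)%N.

(** * Accuracy

    [fnorm] is the Frobenius norm, hence the Euclidean norm on row vectors. *)

Definition fnorm (R : rcfType) (p q : nat) (A : 'M[R]_(p, q)) : R :=
  Num.sqrt (\sum_i \sum_j A i j ^+ 2).

Definition approximates (R : rcfType) (p q : nat) (eps : R)
    (A' A : 'M[R]_(p, q)) : Prop :=
  fnorm (A - A') <= eps * fnorm A.

Definition numerical_rank_le (R : rcfType) (p q : nat) (eps : R) (k : nat)
    (A : 'M[R]_(p, q)) : Prop :=
  exists2 A' : 'M[R]_(p, q), approximates eps A' A & (\rank A' <= k)%N.

(** * Boxes, trees and grids in R^D *)

Definition box (R : realType) (D : nat) (lo sd : 'rV[R]_D) : set 'rV[R]_D :=
  [set p | forall e, lo 0 e <= p 0 e <= lo 0 e + sd 0 e].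

Definition open_box (R : realType) (D : nat) (lo sd : 'rV[R]_D) :
    set 'rV[R]_D :=
  [set p | forall e, lo 0 e < p 0 e < lo 0 e + sd 0 e].

(* Since all boxes of a level are translates of each other, with identically
   placed sample points, a tree with sample points is given by the side lengths
   of the boxes of each level, the displacement [offset l c] (0 < l) of the
   lower corner of the c-th child of a level-l box from that of its parent, and
   the displacement [offset 0 c] of the c-th point of a leaf from the lower
   corner of the leaf. *)
Record sampled_tree (R : realType) (D q1 q : nat) := SampledTree {
  side : nat -> 'rV[R]_D;
  offset : forall l : nat, 'I_(tree_modes q1 q l) -> 'rV[R]_D
}.
Arguments side {R D q1 q} s l.
Arguments offset {R D q1 q} s l c.

Definition is_tree_of_box (R : realType) (D d q1 q : nat)
    (lo sd : 'rV[R]_D) (t : sampled_tree R D q1 q) : Prop :=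
  [/\ side t d.-1 = sd,
      forall l e, (l < d)%N -> 0 < side t l 0 e,
      forall l, (0 < l < d)%N ->
        \bigcup_c box (offset t l c) (side t l.-1) = box 0 (side t l) /\
        forall c c', c != c' ->
          open_box (offset t l c) (side t l.-1) `&`
          open_box (offset t l c') (side t l.-1) = set0 &
      forall c, box 0 (side t 0%N) (offset t 0%N c)].

(* The level-l box containing the points with multi-index [i]; it depends only
   on the components of [i] at positions greater than [l]. *)
Definition tree_box (R : realType) (D d q1 q : nat) (lo : 'rV[R]_D)
    (t : sampled_tree R D q1 q) (l : nat)
    (i : multi_index d (tree_modes q1 q)) : set 'rV[R]_D :=
  box (lo + \sum_(k < d | (l < k)%N) offset t k (i k)) (side t l).

Definition is_tree_sample (R : realType) (D d q1 q : nat) (lo : 'rV[R]_D)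
    (t : sampled_tree R D q1 q)
    (x : 'I_(flat_size d (tree_modes q1 q)) -> 'rV[R]_D) : Prop :=
  forall i : multi_index d (tree_modes q1 q),
    x (flatten_index i) = lo + \sum_(k < d) offset t k (i k).

Definition is_regular_grid (R : realType) (D N : nat) (x : 'I_N -> 'rV[R]_D) :
    Prop :=
  injective x /\
  exists (o h : 'rV[R]_D) (p : 'I_D -> nat), (forall e, 0 < h 0 e) /\
    range x = [set \row_e (o 0 e + h 0 e *+ z e) |
                z in [set z : 'I_D -> nat | forall e, (z e < p e)%N]].

(** * FMM-compressibility *)

Definition set_dist (R : realType) (D : nat) (S T : set 'rV[R]_D) : R :=
  inf [set fnorm (p - q) | p in S & q in T].

Definition set_diam (R : realType) (D : nat) (S : set 'rV[R]_D) : R :=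
  sup [set fnorm (p - q) | p in S & q in S].

Definition well_separated (R : realType) (D : nat) (S T : set 'rV[R]_D) : Prop :=
  Num.max (set_diam S) (set_diam T) <= set_dist S T.

Definition sub_block (R : realType) (D M N : nat)
    (x : 'I_M -> 'rV[R]_D) (y : 'I_N -> 'rV[R]_D)
    (S T : set 'rV[R]_D) (A : 'M[R]_(M, N)) :=
  mxsub (@enum_val _ [pred i | x i \in S]) (@enum_val _ [pred j | y j \in T]) A.

Definition far_field (R : realType) (D d m1 m n1 n : nat) (lo : 'rV[R]_D)
    (Ttrg : sampled_tree R D m1 m) (Tsrc : sampled_tree R D n1 n)
    (l : nat) (i : multi_index d (tree_modes m1 m)) :
    set (multi_index d (tree_modes n1 n)) :=
  [set j | well_separated (tree_box lo Ttrg l i) (tree_box lo Tsrc l j)].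

(* The far field of a box is a set of boxes which need not be well-separated
   from the given box when merged into one set, hence the second clause. *)
Definition fmm_compressible (R : realType) (D d m1 m n1 n : nat)
    (lo sd : 'rV[R]_D)
    (Ttrg : sampled_tree R D m1 m) (Tsrc : sampled_tree R D n1 n)
    (x : 'I_(flat_size d (tree_modes m1 m)) -> 'rV[R]_D)
    (y : 'I_(flat_size d (tree_modes n1 n)) -> 'rV[R]_D)
    (eps : R) (k_eps : nat)
    (A : 'M[R]_(flat_size d (tree_modes m1 m), flat_size d (tree_modes n1 n))) :
    Prop :=
  (forall S T : set 'rV[R]_D, S `<=` box lo sd -> T `<=` box lo sd ->
     well_separated S T ->
     numerical_rank_le eps k_eps (sub_block x y S T A)) /\
  (forall (l : nat) (i : multi_index d (tree_modes m1 m))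
          (F : set (multi_index d (tree_modes n1 n))), (l < d)%N ->
     F `<=` far_field lo Ttrg Tsrc l i ->
     numerical_rank_le eps k_eps
       (sub_block x y (tree_box lo Ttrg l i)
          (\bigcup_(j in F) tree_box lo Tsrc l j) A)).

(** * The Nystroem matrix *)

Definition sampled (R : realType) (D N : nat) (f : 'rV[R]_D -> R)
    (x : 'I_N -> 'rV[R]_D) : 'rV[R]_N := \row_i f (x i).

(* [Q] holds the values which the quadrature uses in place of the possibly
   singular [K 0]. *)
Definition kernel_mx (R : realType) (D M N : nat) (K : R -> R) (Q : 'M[R]_(M, N))
    (x : 'I_M -> 'rV[R]_D) (y : 'I_N -> 'rV[R]_D) : 'M[R]_(M, N) :=
  \matrix_(i, j) if x i == y j then Q i j else K (fnorm (x i - y j)).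

(* a I + B L C with B = diag b and C = diag c; the matrix multiplying [a] is
   [1%:M] when M = N. *)
Definition nystrom_mx (R : realType) (M N : nat) (a : R) (b : 'rV[R]_M)
    (L : 'M[R]_(M, N)) (c : 'rV[R]_N) : 'M[R]_(M, N) :=
  a *: (\matrix_(i, j) ((i : nat) == j)%:R) + diag_mx b *m L *m diag_mx c.

(* Main.v *)
Require Import Defs.
From mathcomp Require Import all_boot all_order all_algebra.
From mathcomp Require Import all_classical all_reals.

Set Implicit Arguments.
Unset Strict Implicit.
Unset Printing Implicit Defensive.

Import Order.TTheory GRing.Theory Num.Theory.

Local Open Scope ring_scope.

(** Entrywise, [diag b *m L *m diag c] is a product: its entry at target index
    i and source index j is b i * L i j * c j.  The tensorized matrix is
    therefore the pointwise product of the tensorizations of [b], [L] and [c],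
    in which the tensor of [b] is read through the target halves of the paired
    modes and the tensor of [c] through the source halves.  Reading a tensor
    through maps of the modes keeps its ranks
    ([has_tt_decomposition_comp]), and a pointwise product multiplies them,
    because the Kronecker products of the cores of the factors are cores for
    the product ([has_tt_decompositionM]).

    The identity contributes the extra 1.  Flattening is injective, so two flat
    indices agree exactly when all their digits agree; [a I] is thus an
    elementary tensor, a product over k of functions of the k-th mode, and has
    all ranks 1 ([has_tt_decomposition_scalar_mx]).  Finally the ranks of a sum
    of tensor trains add up, because block-diagonal cores realize the sum
    ([has_tt_decompositionD]).

    A tensor train value is a sum over whole rank paths.  For the sum of two
    trains, where a rank path would have to be sorted by the block it stays in,
    it is easier to evaluate the train as a product of matrices applied
    successively to the all-ones vector, from the last core to the first; this
    is [tt_eval_backward]. *)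

(** * Injectivity of lexicographic flattening *)

(** The flattened tail is smaller than the factor of the first digit, so this is
    a Euclidean division: the first digit is the quotient and the flattened tail
    the remainder, which lets [flatten_nat_inj] recover the digits one by one. *)
Lemma flatten_nat_recl (d : nat) (s : nat -> nat) (i : 'I_d.+1 -> nat) :
  flatten_nat s i = (i ord0 * flat_size d (fun k => s k.+1)
    + flatten_nat (fun k => s k.+1) (fun k => i (lift ord0 k)))%N.
Proof.
rewrite /flatten_nat /flat_size big_ord_recl; congr (_ * _ + _)%N.
  by rewrite big_mkcond big_ord_recl /= mul1n.
apply: eq_bigr => k _; congr (_ * _)%N.
by rewrite [LHS]big_mkcond big_ord_recl /= mul1n [RHS]big_mkcond.
Qed.

Lemma flatten_nat_inj (d : nat) (s : nat -> nat) (i j : 'I_d -> nat) :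
    (forall k, i k < s k)%N -> (forall k, j k < s k)%N ->
  flatten_nat s i = flatten_nat s j -> i =1 j.
Proof.
elim: d s i j => [|d IHd] s i j lt_is lt_js; first by move=> _ [].
rewrite !flatten_nat_recl => eq_ij.
have lt_i := @flatten_nat_lt d (fun k => s k.+1) (fun k => i (lift ord0 k))
  (fun k => lt_is (lift ord0 k)).
have lt_j := @flatten_nat_lt d (fun k => s k.+1) (fun k => j (lift ord0 k))
  (fun k => lt_js (lift ord0 k)).
have gt0 := leq_ltn_trans (leq0n _) lt_i.
have eq_head : i ord0 = j ord0.
  have := congr1 (divn^~ (flat_size d (fun k => s k.+1))) eq_ij.
  by rewrite /= !divnMDl // !divn_small // !addn0.
move: eq_ij; rewrite eq_head => /addnI eq_tail k.
case: (unliftP ord0 k) => [k'|] -> //.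
exact: (IHd _ _ _ (fun k => lt_is (lift ord0 k))
                  (fun k => lt_js (lift ord0 k)) eq_tail k').
Qed.

Lemma flatten_index_inj (d : nat) (s : nat -> nat) :
  injective (@Defs.flatten_index d s).
Proof.
move=> i j /(congr1 val) eq_ij; apply/ffunP => k; apply: val_inj.
exact: (flatten_nat_inj (fun k => ltn_ord (i k)) (fun k => ltn_ord (j k)) eq_ij).
Qed.

(** * Flattening of pairs *)

Lemma mxvec_unindexK (p q : nat) (e : 'I_(p * q)) :
  mxvec_index (mxvec_unindex e).1 (mxvec_unindex e).2 = e.
Proof.
by rewrite /mxvec_index /mxvec_unindex -surjective_pairing enum_valK cast_ordKV.
Qed.

Lemma mxvec_indexK (p q : nat) (i : 'I_p) (j : 'I_q) :
  mxvec_unindex (mxvec_index i j) = (i, j).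
Proof. by rewrite /mxvec_unindex cast_ordK enum_rankK. Qed.

(** * Tensor trains as iterated matrix-vector products *)

Definition tt_cores (R : Type) (s r : nat -> nat) :=
  forall k : nat, 'I_(r k) -> 'I_(s k) -> 'I_(r k.+1) -> R.

(** [u k] is the vector of partial evaluations from position [k] on: its entry
    at [p] is the sum over the rank paths that start at [p] and use the cores
    [k], ..., [d - 1]. *)
Definition tt_backward (R : pzSemiRingType) (d : nat) (s r : nat -> nat)
    (G : tt_cores R s r) (i : multi_index d s)
    (u : forall k : nat, 'I_(r k) -> R) : Prop :=
  (forall p, u d p = 1) /\
  forall (k : 'I_d) p, u k p = \sum_q G k p (i k) q * u k.+1 q.

(** The type of entry [k] of a rank path depends on [k].  Matching on the natural
    number [k], with the bound as an argument, makes the entries [0] and [k.+1]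
    have the right type by computation, without transport. *)
Definition cons_index_at (d : nat) (r : nat -> nat) (p : 'I_(r 0%N))
    (al : multi_index d (fun k => r k.+1)) (k : nat) :
    (k < d.+1)%N -> 'I_(r k) :=
  match k with
  | 0%N => fun _ => p
  | k'.+1 => fun lt_k => al (@Ordinal d k' lt_k)
  end.

Definition cons_index (d : nat) (r : nat -> nat) (p : 'I_(r 0%N))
    (al : multi_index d (fun k => r k.+1)) : multi_index d.+1 r :=
  [ffun k : 'I_d.+1 => cons_index_at p al (ltn_ord k)].

Lemma cons_index0 d r p al : @cons_index d r p al ord0 = p.
Proof. by rewrite ffunE. Qed.

Lemma cons_indexS d r p al (k : 'I_d) :
  @cons_index d r p al (lift ord0 k) = al k.
Proof.
rewrite ffunE; case: k => k lt_k.
move: (ltn_ord _) => lt_k'.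
change (al (@Ordinal d k lt_k') = al (Ordinal lt_k)).
by rewrite (bool_irrelevance lt_k' lt_k).
Qed.

Lemma cons_index_widenS d r p al (k : 'I_d) :
  @cons_index d.+1 r p al (widen_ord (leqnSn d.+1) (lift ord0 k))
    = al (widen_ord (leqnSn d) k).
Proof.
rewrite ffunE; case: k => k lt_k.
move: (ltn_ord _) => lt_k'; rewrite /(widen_ord _ (Ordinal _)).
move: (widen_ord_proof _ _) => lt_k''.
change (al (@Ordinal d.+1 k lt_k') = al (@Ordinal d.+1 k lt_k'')).
by rewrite (bool_irrelevance lt_k' lt_k'').
Qed.

Lemma cons_index_widen0 d r p al :
  @cons_index d.+1 r p al (widen_ord (leqnSn d.+1) ord0) = p.
Proof. by rewrite ffunE. Qed.

Definition tail_index d r (al : multi_index d.+1 r) :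
    multi_index d (fun k => r k.+1) :=
  [ffun k : 'I_d => al (lift ord0 k)].

Lemma tail_indexE d r (al : multi_index d.+1 r) (k : 'I_d) :
  tail_index al k = al (lift ord0 k).
Proof. by rewrite ffunE. Qed.

Lemma cons_tail_index d r (al : multi_index d.+1 r) :
  cons_index (al ord0) (tail_index al) = al.
Proof.
apply/ffunP => k; case: (unliftP ord0 k) => [k'|] ->.
  by rewrite cons_indexS tail_indexE.
by rewrite cons_index0.
Qed.

Lemma sum_multi_index_recl (R : pzSemiRingType) d r
    (F : multi_index d.+1 r -> R) :
  \sum_al F al = \sum_p \sum_al F (cons_index p al).
Proof.
rewrite pair_big /=.
rewrite (reindex (fun x : 'I_(r 0%N) * multi_index d (fun k => r k.+1) =>
  cons_index x.1 x.2)) //.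
exists (fun al : multi_index d.+1 r => (al ord0, tail_index al)) =>
  [[p al] _|al _] /=.
  rewrite cons_index0; congr (_, _).
  by apply/ffunP => k; rewrite ffunE cons_indexS.
exact: cons_tail_index.
Qed.

(** Splitting off the first entry of the rank paths turns the sum over paths
    into one step of the recursion, so the partial sums over the paths starting
    at [p] add up to [u 0 p]. *)
Lemma tt_eval_backward (R : pzSemiRingType) d s r (G : tt_cores R s r)
    (i : multi_index d s) u :
  tt_backward G i u -> tt_eval G i = \sum_p u 0%N p.
Proof.
suff path_sum (p : 'I_(r 0%N)) : tt_backward G i u ->
    \sum_(al : multi_index d (fun k => r k.+1))
      \prod_(k < d) G k (cons_index p al (widen_ord (leqnSn d) k)) (i k)
                        (cons_index p al (lift ord0 k)) = u 0%N p.
  move=> Gu; rewrite /tt_eval [LHS]sum_multi_index_recl.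
  by apply: eq_bigr => p _; apply: path_sum.
elim: d s r G i u p => [|d IHd] s r G i u p [u1 uG].
  (* There is exactly one path with no entry after [p]. *)
  under eq_bigr do rewrite big_ord0.
  rewrite sumr_const u1 (_ : #|_| = 1%N) //.
  rewrite -(card1 ([ffun k : 'I_0 => False_rect 'I_(r k.+1) (notF (ltn_ord k))]
    : multi_index 0 (fun k => r k.+1))).
  by apply: eq_card => al; rewrite !inE; apply/esym/eqP/ffunP => -[].
rewrite (uG ord0) [LHS]sum_multi_index_recl; apply: eq_bigr => q _.
have IHq := IHd _ _ (fun k => G k.+1) (tail_index i) (fun k => u k.+1) q.
rewrite -IHq; last first.
  by split=> // k p'; rewrite tail_indexE; exact: (uG (lift ord0 k)).
rewrite big_distrr; apply: eq_bigr => al _ /=.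
rewrite big_ord_recl cons_index_widen0 cons_indexS cons_index0; congr (_ * _).
by apply: eq_bigr => k _; rewrite cons_index_widenS cons_indexS tail_indexE.
Qed.

Lemma exists_tt_backward (R : pzSemiRingType) d s r (G : tt_cores R s r)
    (i : multi_index d s) :
  exists u, tt_backward G i u.
Proof.
elim: d s r G i => [|d IHd] s r G i.
  by exists (fun _ _ => 1); split=> // -[].
have [u [u1 uG]] := IHd _ _ (fun k => G k.+1) (tail_index i).
exists (fun k => match k with
  | 0%N => fun p => \sum_q G 0%N p (i ord0) q * u 0%N q
  | k'.+1 => u k'
  end); split=> // k.
by case: (unliftP ord0 k) => [k'|] -> //= p; rewrite uG tail_indexE.
Qed.

(** * Mode maps, products and elementary tensors *)

Lemma has_tt_decomposition_comp (R : pzSemiRingType) d s s' r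
    (f : forall k, 'I_(s' k) -> 'I_(s k)) (T : tensor R d s) :
  has_tt_decomposition T r ->
  has_tt_decomposition
    (fun i : multi_index d s' => T [ffun k : 'I_d => f k (i k)]) r.
Proof.
case=> r0 rd [G TG]; split=> //; exists (fun k p i q => G k p (f k i) q) => i.
rewrite TG; apply: eq_bigr => al _; apply: eq_bigr => k _.
by rewrite ffunE.
Qed.

(** The cores of the product are the Kronecker products of the cores: pairs of
    rank paths correspond to rank paths of pairs, and [pair_index] is this
    correspondence. *)
Lemma has_tt_decompositionM (R : comPzSemiRingType) d s r1 r2
    (T1 T2 : tensor R d s) :
    has_tt_decomposition T1 r1 -> has_tt_decomposition T2 r2 ->
  has_tt_decomposition (fun i => T1 i * T2 i) (fun k => r1 k * r2 k)%N.
Proof.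
case=> r10 r1d [G1 TG1] [r20 r2d [G2 TG2]]; split; rewrite ?r10 ?r1d ?r20 ?r2d //.
pose G : tt_cores R s (fun k => r1 k * r2 k)%N := fun k p i q =>
  G1 k (mxvec_unindex p).1 i (mxvec_unindex q).1 *
  G2 k (mxvec_unindex p).2 i (mxvec_unindex q).2.
exists G => i.
rewrite TG1 TG2 /tt_eval big_distrlr pair_big /=.
rewrite [RHS](reindex (fun al : multi_index d.+1 r1 * multi_index d.+1 r2 =>
  pair_index al.1 al.2)) /=.
  apply: eq_bigr => -[al1 al2] _ /=; rewrite -big_split /=.
  by apply: eq_bigr => k _; rewrite /G !ffunE !mxvec_indexK.
exists (fun al => ([ffun k : 'I_d.+1 => (mxvec_unindex (al k)).1],
                   [ffun k : 'I_d.+1 => (mxvec_unindex (al k)).2])).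
  move=> [al1 al2] _; congr (_, _);
  by apply/ffunP => k; rewrite !ffunE mxvec_indexK.
by move=> al _; apply/ffunP => k; rewrite !ffunE mxvec_unindexK.
Qed.

Lemma has_tt_decomposition_elementary (R : pzSemiRingType) d s
    (f : forall k : nat, 'I_(s k) -> R) :
  has_tt_decomposition (fun i : multi_index d s => \prod_(k < d) f k (i k))
    (fun=> 1%N).
Proof.
split=> //; exists (fun k _ i _ => f k i) => i; rewrite /tt_eval.
rewrite (big_pred1 ([ffun=> ord0] : multi_index d.+1 (fun=> 1%N))) //.
by move=> al; apply/esym/eqP/ffunP => k; rewrite !ord1.
Qed.

(** * Sums *)

(** With block-diagonal cores the partial evaluations are the concatenations of
    those of the two trains.  [tt_eval] also sums over the boundary indices, so
    the direct sum is exact although its boundary ranks are not 1;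
    [tt_eval_close] repairs this. *)
Lemma tt_eval_direct_sum (R : pzSemiRingType) d s r1 r2
    (G1 : tt_cores R s r1) (G2 : tt_cores R s r2) :
  exists G : tt_cores R s (fun k => r1 k + r2 k)%N,
    forall i : multi_index d s, tt_eval G i = tt_eval G1 i + tt_eval G2 i.
Proof.
exists (fun k p i q =>
  match fintype.split p, fintype.split q with
  | inl p1, inl q1 => G1 k p1 i q1
  | inr p2, inr q2 => G2 k p2 i q2
  | _, _ => 0
  end) => i.
have [u1 Gu1] := exists_tt_backward G1 i.
have [u2 Gu2] := exists_tt_backward G2 i.
rewrite (tt_eval_backward Gu1) (tt_eval_backward Gu2).
set G := (X in tt_eval X).
pose u k (p : 'I_(r1 k + r2 k)) :=
  match fintype.split p with inl p1 => u1 k p1 | inr p2 => u2 k p2 end.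
have uL k p : u k (lshift _ p) = u1 k p by rewrite /u (unsplitK (inl p)).
have uR k p : u k (rshift _ p) = u2 k p by rewrite /u (unsplitK (inr p)).
case: Gu1 => [u11 u1G]; case: Gu2 => [u21 u2G].
rewrite (@tt_eval_backward _ _ _ _ _ _ u).
  by rewrite big_split_ord; congr (_ + _); apply: eq_bigr => p _; rewrite ?uL ?uR.
split=> [p|k p]; first by rewrite /u; case: (fintype.split p).
rewrite big_split_ord /= /G -(splitK p).
case: (fintype.split p) => p' /=; rewrite ?uL ?uR ?u1G ?u2G.
  rewrite [X in _ + X]big1 ?addr0 => [|q _].
    by apply: eq_bigr => q _; rewrite uL (unsplitK (inl p')) (unsplitK (inl q)).
  by rewrite (unsplitK (inl p')) (unsplitK (inr q)) mul0r.
rewrite [X in X + _]big1 ?add0r => [|q _].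
  by apply: eq_bigr => q _; rewrite uR (unsplitK (inr p')) (unsplitK (inr q)).
by rewrite (unsplitK (inr p')) (unsplitK (inl q)) mul0r.
Qed.

Definition closed_ranks (d : nat) (r : nat -> nat) (k : nat) : nat :=
  if (k == 0%N) || (k == d) then 1%N else r k.

(** Applying two identity matrices, in a form where their common size is allowed
    to be written in two ways. *)
Lemma sum_delta_delta (R : pzSemiRingType) (p q : nat) (u : 'I_p -> R)
    (i : 'I_p) : q = p ->
  \sum_(j < q) ((i : nat) == j)%:R * (\sum_(l < p) ((j : nat) == l)%:R * u l)
    = u i.
Proof.
move=> eq_qp; subst q.
have sum_delta (v : 'I_p -> R) (j : 'I_p) :
      \sum_(l < p) ((j : nat) == l)%:R * v l = v j.
  rewrite (bigD1 j) //= eqxx mul1r big1 ?addr0 // => l /negPf ne_lj.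
  by rewrite eq_sym (inj_eq val_inj) ne_lj mul0r.
by rewrite !sum_delta.
Qed.

(** The free boundary indices are summed into the outer cores.  The first core
    is multiplied on the left by an all-ones row and the last one on the right
    by an all-ones column; [E] and [F] are these vectors at the ends and the
    identity in between, so that the inner partial evaluations do not change. *)
Lemma tt_eval_close (R : pzSemiRingType) d s r (G : tt_cores R s r) :
    (0 < d)%N ->
  exists G' : tt_cores R s (closed_ranks d r),
    forall i : multi_index d s, tt_eval G' i = tt_eval G i.
Proof.
move=> d_gt0.
pose E k (p' : 'I_(closed_ranks d r k)) (p : 'I_(r k)) : R :=
  if k == 0%N then 1 else ((p' : nat) == p)%:R.
pose F k (p : 'I_(r k)) (p' : 'I_(closed_ranks d r k)) : R :=
  if k == d then 1 else ((p : nat) == p')%:R.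
exists (fun k p' i q' => \sum_p E k p' p * \sum_q G k p i q * F k.+1 q q') => i.
have [u Gu] := exists_tt_backward G i.
rewrite (tt_eval_backward Gu); case: Gu => [u1 uG].
pose u' k (p' : 'I_(closed_ranks d r k)) : R :=
  if k == d then 1 else \sum_p E k p' p * u k p.
(* Absorbing [F] into the next vector recovers the original one. *)
have FE (k : 'I_d) q : \sum_q' F k.+1 q q' * u' k.+1 q' = u k.+1 q.
  have [k1d | ne_k1d] := eqVneq k.+1 d.
    have -> : u k.+1 q = 1.
      have u_last j : j = d -> forall p, u j p = 1 by move=> ->.
      exact: u_last.
    have sz : closed_ranks d r k.+1 = 1%N by rewrite /closed_ranks k1d eqxx orbT.
    under eq_bigr do rewrite /F /u' (introT eqP k1d) mul1r.
    by rewrite sumr_const card_ord sz.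
  rewrite /u' /F (negPf ne_k1d); apply: sum_delta_delta.
  by rewrite /closed_ranks (negPf ne_k1d).
rewrite (@tt_eval_backward _ _ _ _ _ _ u').
  by rewrite big_ord1 /u' eq_sym gtn_eqF //; apply: eq_bigr => p _; rewrite mul1r.
split=> [p|k p']; first by rewrite /u' eqxx.
rewrite {1}/u' (ltn_eqF (ltn_ord k)).
under [RHS]eq_bigr do rewrite big_distrl /=.
rewrite [RHS]exchange_big; apply: eq_bigr => p _ /=.
under [RHS]eq_bigr do rewrite -mulrA.
rewrite -big_distrr uG /=; congr (_ * _).
under [RHS]eq_bigr do rewrite big_distrl /=.
rewrite [RHS]exchange_big; apply: eq_bigr => q _ /=.
under [RHS]eq_bigr do rewrite -mulrA.
by rewrite -big_distrr FE.
Qed.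

Lemma has_tt_decompositionD (R : pzSemiRingType) d s r1 r2
    (T1 T2 : tensor R d s) : (0 < d)%N ->
    has_tt_decomposition T1 r1 -> has_tt_decomposition T2 r2 ->
  has_tt_decomposition (fun i => T1 i + T2 i)
    (closed_ranks d (fun k => r1 k + r2 k)%N).
Proof.
move=> d_gt0 [_ _ [G1 TG1]] [_ _ [G2 TG2]].
have [G GE] := @tt_eval_direct_sum R d _ _ _ G1 G2.
have [G' G'E] := tt_eval_close G d_gt0.
split; rewrite /closed_ranks ?eqxx ?orbT //.
by exists G' => i; rewrite G'E GE TG1 TG2.
Qed.

(** * The identity *)

(** The factor [a] is put into the function of the first mode, which exists
    since [0 < d].  Equal digits mean equal flat indices only when both sides
    are flattened with the same mode sizes; for [a = 0] both sides vanish. *)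
Lemma has_tt_decomposition_scalar_mx (R : comPzSemiRingType) d s t (a : R) :
    (0 < d)%N -> (a != 0 -> s = t) ->
  has_tt_decomposition
    (tensor_of_mx (a *: (\matrix_(i < flat_size d s, j < flat_size d t)
                           ((i : nat) == j)%:R)))
    (fun=> 1%N).
Proof.
move=> d_gt0 eq_st.
have [r0 rd [G GE]] := @has_tt_decomposition_elementary R d
  (fun k => s k * t k)%N (fun k e => (if k == 0%N then a else 1) *
    ((mxvec_unindex e).1 == (mxvec_unindex e).2 :> nat)%:R).
split=> //; exists G => u; rewrite -GE /tensor_of_mx !mxE.
pose same k := (mxvec_unindex (u k)).1 == (mxvec_unindex (u k)).2 :> nat.
have -> : \prod_(k < d) ((if k == 0%N :> nat then a else 1) * (same k)%:R)
    = a * [forall k, same k]%:R.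
  have [/forallP all_same|] := boolP [forall k, same k].
    rewrite mulr1 (bigD1 (Ordinal d_gt0)) //= all_same mulr1 big1 ?mulr1 // => k.
    by rewrite -val_eqE all_same /= => /negPf ->; rewrite mulr1.
  rewrite negb_forall => /existsP [k /negPf ne_k].
  by rewrite (bigD1 k) //= ne_k !mulr0 mul0r.
have [->|a_neq0] := eqVneq a 0; first by rewrite !mul0r.
have {}eq_st := eq_st a_neq0; subst t.
congr (a * (nat_of_bool _)%:R); apply/eqP/forallP => [eq_flat k|eq_digits].
  move/val_inj/flatten_index_inj/ffunP/(_ k): eq_flat.
  by rewrite /same !ffunE => ->.
by congr (flatten_nat _); apply/funext => k; rewrite !ffunE; apply/eqP/eq_digits.
Qed.

(** * The rank bound *)

Theorem mainTheorem2 (R : realType) (D : nat)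
    (lo sd : 'rV[R]_D)
    (a : R) (b c : 'rV[R]_D -> R) (K : R -> R)
    (eps : R) (k_eps rb rK rc : nat)
    (d m1 m n1 n : nat)
    (Ttrg : sampled_tree R D m1 m) (Tsrc : sampled_tree R D n1 n)
    (x : 'I_(flat_size d (tree_modes m1 m)) -> 'rV[R]_D)
    (y : 'I_(flat_size d (tree_modes n1 n)) -> 'rV[R]_D)
    (w : 'rV[R]_(flat_size d (tree_modes n1 n)))
    (Q KW KW_eps :
       'M[R]_(flat_size d (tree_modes m1 m), flat_size d (tree_modes n1 n)))
    (b_eps : 'rV[R]_(flat_size d (tree_modes m1 m)))
    (c_eps : 'rV[R]_(flat_size d (tree_modes n1 n)))
    (rk_b rk_K rk_c : nat -> nat) :
  (1 <= D <= 3)%N ->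
  (forall e, 0 < sd 0 e) ->
  0 <= eps ->
  (0 < d)%N ->
  is_tree_of_box d lo sd Ttrg ->
  is_tree_of_box d lo sd Tsrc ->
  is_tree_sample lo Ttrg x ->
  is_tree_sample lo Tsrc y ->
  is_regular_grid x ->
  is_regular_grid y ->
  (a != 0 -> m1 = n1 /\ m = n) ->
  KW = kernel_mx K Q x y *m diag_mx w ->
  fmm_compressible lo sd Ttrg Tsrc x y eps k_eps KW ->
  approximates eps KW_eps KW ->
  has_tt_decomposition (tensor_of_mx KW_eps) rk_K ->
  (max_tt_rank d rk_K <= rK)%N ->
  approximates eps b_eps (sampled b x) ->
  has_tt_decomposition (tensor_of_row b_eps) rk_b ->
  (max_tt_rank d rk_b <= rb)%N ->
  approximates eps c_eps (sampled c y) ->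
  has_tt_decomposition (tensor_of_row c_eps) rk_c ->
  (max_tt_rank d rk_c <= rc)%N ->
  exists rk : nat -> nat,
    has_tt_decomposition (tensor_of_mx (nystrom_mx a b_eps KW_eps c_eps)) rk /\
    (max_tt_rank d rk <= rb * rK * rc + 1)%N.
Proof.
move=> _ _ _ d_gt0 _ _ _ _ _ _ eq_modes _ _ _ ttK le_rK _ ttb le_rb _ ttc le_rc.
have {ttb}ttb := @has_tt_decomposition_comp _ _ _
  (fun k => tree_modes m1 m k * tree_modes n1 n k)%N _
  (fun k e => (mxvec_unindex e).1) _ ttb.
have {ttc}ttc := @has_tt_decomposition_comp _ _ _
  (fun k => tree_modes m1 m k * tree_modes n1 n k)%N _
  (fun k e => (mxvec_unindex e).2) _ ttc.
have ttBKC := has_tt_decompositionM (has_tt_decompositionM ttb ttK) ttc.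
have eq_tree_modes : a != 0 -> tree_modes m1 m = tree_modes n1 n.
  by move=> /eq_modes [-> ->].
have ttI := has_tt_decomposition_scalar_mx d_gt0 eq_tree_modes.
have [r0 rd [G GE]] := has_tt_decompositionD d_gt0 ttBKC ttI.
exists (closed_ranks d (fun k => rk_b k * rk_K k * rk_c k + 1)%N); split.
  split=> //; exists G => u; rewrite -GE /tensor_of_mx /nystrom_mx mxE addrC.
  by rewrite mul_mx_diag mul_diag_mx !mxE.
(* Only the inner ranks are sums; the closed ends have rank 1. *)
apply/bigmax_leqP_seq => k; rewrite mem_index_iota => le_k _.
have le_max r : (r k <= max_tt_rank d r)%N.
  by apply: leq_bigmax_seq; rewrite ?mem_index_iota.
rewrite /closed_ranks; case: ifP => _; first by rewrite addn1.
rewrite leq_add2r; apply: leq_mul; last exact: leq_trans (le_max _) le_rc.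
by apply: leq_mul; [apply: leq_trans (le_max _) le_rb
                   |apply: leq_trans (le_max _) le_rK].
Qed.
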